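(* There exists a sequence $(\mathcal A_n)_{n\in\mathbb N}$ of Banach algebras, each possessing a multiplicative identity (whose norm is not required to be $1$), such that $\mathrm{Asy}(\mathcal A_n)$ does not possess a multiplicative identity.
   Context: In this statement a Banach algebra is a complex complete normed algebra with contractive product $\|ab\|\le\|a\|\|b\|$; a multiplicative identity is an element $e$ with $ea=ae=a$ for all $a$, with no condition on $\|e\|$. For a sequence $(\mathcal A_n)$ of Banach algebras, $\ell^\infty(\mathcal A_n)$ is the Banach algebra of all bounded sequences $(a_n)$ with $a_n\in\mathcal A_n$, with pointwise operations and the supremum norm; $c_0(\mathcal A_n)$ is the closed two-sided ideal of sequences with $\lim_{n\to\infty}\|a_n\|=0$; and $\mathrm{Asy}(\mathcal A_n)=\ell^\infty(\mathcal A_n)/c_0(\mathcal A_n)$ with the quotient norm. *)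

(* Defs.v *)
From HB Require Import structures.
From mathcomp Require Import all_boot all_order all_algebra.
From mathcomp Require Import generic_quotient ring_quotient complex.
From mathcomp Require Import all_classical all_reals all_analysis.
From mathcomp Require Import lra.

Set Implicit Arguments.
Unset Strict Implicit.
Unset Printing Implicit Defensive.

Import Order.TTheory GRing.Theory Num.Theory.
Import numFieldNormedType.Exports.

Local Open Scope classical_set_scope.
Local Open Scope complex_scope.
Local Open Scope ring_scope.
Local Open Scope quotient_scope.

(* Banach algebras need not be unital here, so the product cannot be the ring
   product of MathComp, whose rings all have a unit. *)
HB.mixin Record CompleteNormedModule_isBanachAlgebra (K : numFieldType) A
    & CompleteNormedModule K A := {
  bmul : A -> A -> A;
  bmulA : associative bmul;
  bmulDl : left_distributive bmul +%R;
  bmulDr : right_distributive bmul +%R;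
  bmulZl : forall (k : K) (x y : A), bmul (k *: x) y = k *: bmul x y;
  bmulZr : forall (k : K) (x y : A), bmul x (k *: y) = k *: bmul x y;
  bmul_norm_le : forall x y : A, `|bmul x y| <= `|x| * `|y|
}.

#[short(type="banachAlgType")]
HB.structure Definition BanachAlgebra (K : numFieldType) :=
  {A of CompleteNormedModule K A & CompleteNormedModule_isBanachAlgebra K A}.

Notation "x ** y" := (bmul x y) (at level 40, left associativity) : ring_scope.

Definition has_identity (K : numFieldType) (A : banachAlgType K) : Prop :=
  exists e : A, forall a : A, e ** a = a /\ a ** e = a.

Section BanachAlgebraTheory.
Variables (K : numFieldType) (A : banachAlgType K).
Implicit Types x y z : A.

Lemma bmulBl x y z : (x - y) ** z = x ** z - y ** z.
Proof. by rewrite bmulDl -(scaleN1r y) bmulZl scaleN1r. Qed.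

Lemma bmulBr z x y : z ** (x - y) = z ** x - z ** y.
Proof. by rewrite bmulDr -(scaleN1r y) bmulZr scaleN1r. Qed.

End BanachAlgebraTheory.

Section RealNorm.
Variable R : realType.

Lemma ger0_ReE (z : R[i]) : 0 <= z -> z = (complex.Re z)%:C.
Proof. by case: z => a b; move=> /ger0_Im /= ->. Qed.

(* The norm of a normed module over R[i] takes its values in R[i]; rnorm is the
   same norm seen in R. *)
Definition rnorm (V : normedZmodType R[i]) (x : V) : R := complex.Re `|x|.

Section normedZmod.
Variable V : normedZmodType R[i].
Implicit Types x y z : V.

Lemma rnormE x : (rnorm x)%:C = `|x|.
Proof. by rewrite /rnorm -ger0_ReE. Qed.

Lemma rnorm_ge0 x : 0 <= rnorm x.
Proof. by rewrite -ler0c rnormE normr_ge0. Qed.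

Lemma rnormD x y : rnorm (x + y) <= rnorm x + rnorm y.
Proof. by rewrite -lecR rmorphD /= !rnormE ler_normD. Qed.

Lemma rnormN x : rnorm (- x) = rnorm x.
Proof. by rewrite /rnorm normrN. Qed.

Lemma rnorm_distC x y : rnorm (x - y) = rnorm (y - x).
Proof. by rewrite -rnormN opprB. Qed.

Lemma rnorm_distD y x z : rnorm (x - z) <= rnorm (x - y) + rnorm (y - z).
Proof. by apply: le_trans (rnormD _ _); rewrite addrA subrK. Qed.

Lemma rnorm0 : rnorm (0 : V) = 0.
Proof. by rewrite /rnorm normr0. Qed.

Lemma rnorm_eq0 x : rnorm x = 0 -> x = 0.
Proof. by move=> x0; apply/normr0_eq0; rewrite -rnormE x0. Qed.

End normedZmod.

Lemma rnormZ (V : normedModType R[i]) (k : R[i]) (x : V) :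
  rnorm (k *: x) = complex.Re `|k| * rnorm x.
Proof.
apply: complexI; rewrite rnormE normrZ -rnormE rmorphM; congr (_ * _).
by apply: ger0_ReE; exact: normr_ge0.
Qed.

Lemma rnormM (A : banachAlgType R[i]) (x y : A) :
  rnorm (x ** y) <= rnorm x * rnorm y.
Proof. by rewrite -lecR rmorphM /= !rnormE bmul_norm_le. Qed.

Lemma Re_norm_ge0 (k : R[i]) : 0 <= complex.Re `|k|.
Proof. by have := normr_ge0 k; rewrite lecE /= => /andP[]. Qed.

End RealNorm.

Section FastCauchy.
Variable R : realType.
Implicit Type V : normedModType R[i].

Let h (k : nat) : R := 2^-1 ^+ k.

Let h_gt0 k : 0 < h k. Proof. by rewrite exprn_gt0. Qed.

Let hS k : h k.+1 *+ 2 = h k.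
Proof. by rewrite /h exprS mulr2n; lra. Qed.

Let h_small (e : R) : 0 < e -> exists k, h k *+ 4 < e.
Proof.
move=> e0.
have : (fun n => 2^-1 ^+ n : R) @ \oo --> (0 : R).
  by apply: cvg_expr; rewrite ger0_norm // invf_lt1 // ltr1n.
move=> /cvgrPdist_lt/(_ (e / 4)); rewrite divr_gt0 // => /(_ isT) [N _ /(_ N)].
rewrite /= leqnn sub0r normrN ger0_norm ?exprn_ge0 // => /(_ isT).
rewrite ltr_pdivlMr // => hN; exists N.
by rewrite -mulr_natr.
Qed.

(* Completeness is checked on the sequences with rnorm (u k.+1 - u k) < 2^-k,
   which lift through the quotient map; complete_fast and fast_complete_cvg
   relate it to the filter-based completeness of the library. *)
Definition fast_cauchy V (u : nat -> V) :=
  forall k, rnorm (u k.+1 - u k) < 2^-1 ^+ k.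

Definition fast_complete V :=
  forall u : nat -> V, fast_cauchy u ->
  exists l : V, forall k, rnorm (u k - l) <= 2^-1 ^+ k *+ 2.

Lemma fast_cauchy_dist V (u : nat -> V) k m :
  fast_cauchy u -> rnorm (u (k + m)%N - u k) <= h k *+ 2.
Proof.
move=> fu.
suff: rnorm (u (k + m)%N - u k) <= h k *+ 2 - h (k + m) *+ 2.
  by move/le_trans; apply; rewrite gerBl mulrn_wge0 // ltW.
elim: m => [|m IH]; first by rewrite addn0 !subrr rnorm0.
apply: (le_trans (rnorm_distD (u (k + m)%N) _ _)).
have := fu (k + m)%N; rewrite -addnS -/(h (k + m)) => /ltW f.
have := hS (k + m); rewrite -addnS => hk.
move: f IH hk; rewrite !mulr2n; lra.
Qed.

Lemma complete_fast (V : completeNormedModType R[i]) : fast_complete V.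
Proof.
move=> u fu.
have uc : cauchy (u @ \oo).
  apply/cauchy_ballP => e e0.
  have Re0 : 0 < complex.Re e by move: e0; rewrite ltcE /= => /andP[].
  have eE := ger0_ReE (ltW e0).
  have [k hk] := h_small Re0.
  exists ([set y | rnorm (y - u k) <= h k *+ 2],
          [set y | rnorm (y - u k) <= h k *+ 2]) => /=.
    by split; exists k => // n /= kn; rewrite -(subnKC kn) fast_cauchy_dist.
  move=> [x y] [/= xk yk]; rewrite -ball_normE /= eE -rnormE ltcR.
  apply: le_lt_trans (rnorm_distD (u k) _ _) _.
  rewrite (rnorm_distC (u k)); apply: le_lt_trans hk.
  by apply: le_trans (lerD xk yk) _; rewrite -mulrnDr.
have /cvg_ex[l ul] : cvg (u @ \oo) by exact: cauchy_cvg.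
exists l => k; apply/ler_addgt0Pr => e e0.
have : \forall n \near \oo, `|l - u n| < e%:C.
  have := ul; move/cvgrPdist_lt; apply; by rewrite ltcR.
move=> [N _ /(_ (k + N)%N)]; rewrite /= leq_addl => /(_ isT).
rewrite -rnormE ltcR => lN.
apply: le_trans (rnorm_distD (u (k + N)%N) _ _) _.
by rewrite lerD // ?(rnorm_distC (u (k + N)%N)) ?(ltW lN) // rnorm_distC fast_cauchy_dist.
Qed.

Lemma fast_complete_cvg V : fast_complete V ->
  forall F : set_system V, ProperFilter F -> cauchy F -> cvg F.
Proof.
move=> cV F FF /cauchy_ballP Fc.
have B k : exists B : set V, F B /\ forall x y, B x -> B y -> rnorm (x - y) < h k.
  have h0 : 0 < (h k)%:C by rewrite ltcR.
  have [[P Q] /= [FP FQ] PQ] := Fc _ h0.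
  exists (P `&` Q); split; first exact: filterI.
  move=> x y [Px _] [_ Qy]; have := PQ (x, y) (conj Px Qy).
  by rewrite -ball_normE /= -rnormE ltcR.
have [C CP] := choice B.
pose D k : set V := [set x | forall i, (i <= k)%N -> C i x].
have FD k : F (D k).
  elim: k => [|k IH]; first by apply: filterS (CP 0%N).1 => x Cx [].
  apply: filterS2 IH (CP k.+1).1 => x Dx Cx i.
  by rewrite leq_eqVlt => /predU1P[->|/Dx].
have /choice[u Du] k : exists x, D k x by apply: filter_ex (FD k).
have fu : fast_cauchy u.
  move=> k; apply: (CP k).2; first exact: (Du k.+1 k (leqnSn k)).
  exact: (Du k k (leqnn k)).
have [l lP] := cV u fu.
apply/cvg_ex; exists l; apply/cvgrPdist_lt => e e0.
have Re0 : 0 < complex.Re e by move: e0; rewrite ltcE /= => /andP[].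
have eE := ger0_ReE (ltW e0).
have [k hk] := h_small Re0.
apply: filterS (FD k) => x Dx /=; rewrite eE -rnormE ltcR.
apply: le_lt_trans (rnorm_distD (u k) _ _) _; rewrite rnorm_distC.
have uk : rnorm (u k - x) < h k.
  by apply: (CP k).2; [exact: (Du k k (leqnn k))|exact: Dx].
have := lP k; rewrite -/(h k) => lk; have := h_gt0 k.
move: hk lk uk; rewrite -(mulr_natr _ 4) mulr2n; lra.
Qed.

End FastCauchy.

Section BoundedSequences.
Variables (R : realType) (A : nat -> banachAlgType R[i]).

Definition bounded_seq (a : forall n, A n) :=
  exists M : R, forall n, rnorm (a n) <= M.

Record linf := Linf {
  linf_val :> forall n, A n;
  linf_bounded : bounded_seq linf_val }.

Implicit Types a b c : linf.

Lemma linfP a b : (forall n, a n = b n) -> a = b.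
Proof.
case: a b => [a aM] [b bM] /= ab.
have {}ab : a = b by apply: functional_extensionality_dep.
by case: _ / ab bM => bM; congr Linf; exact: Prop_irrelevance.
Qed.

HB.instance Definition _ := gen_eqMixin linf.
HB.instance Definition _ := gen_choiceMixin linf.

Let bounded_zero : bounded_seq (fun n => 0).
Proof. by exists 0 => n; rewrite rnorm0. Qed.
Definition linf_zero := Linf bounded_zero.

Let bounded_opp a : bounded_seq (fun n => - a n).
Proof. by case: (linf_bounded a) => M aM; exists M => n; rewrite rnormN. Qed.
Definition linf_opp a := Linf (bounded_opp a).

Let bounded_add a b : bounded_seq (fun n => a n + b n).
Proof.
case: (linf_bounded a) (linf_bounded b) => M aM [N bN]; exists (M + N) => n.
by apply: le_trans (rnormD _ _) _; rewrite lerD.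
Qed.
Definition linf_add a b := Linf (bounded_add a b).

Let bounded_scale (k : R[i]) a : bounded_seq (fun n => k *: a n).
Proof.
case: (linf_bounded a) => M aM; exists (complex.Re `|k| * M) => n.
by rewrite rnormZ; apply: ler_wpM2l; [exact: Re_norm_ge0|exact: aM].
Qed.
Definition linf_scale (k : R[i]) a := Linf (bounded_scale k a).

Let bounded_mul a b : bounded_seq (fun n => a n ** b n).
Proof.
case: (linf_bounded a) (linf_bounded b) => M aM [N bN]; exists (M * N) => n.
by apply: le_trans (rnormM _ _) _; rewrite ler_pM ?rnorm_ge0.
Qed.
Definition linf_mul a b := Linf (bounded_mul a b).

Let addA : associative linf_add.
Proof. by move=> a b c; apply: linfP => n /=; rewrite addrA. Qed.
Let addC : commutative linf_add.
Proof. by move=> a b; apply: linfP => n /=; rewrite addrC. Qed.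
Let add0 : left_id linf_zero linf_add.
Proof. by move=> a; apply: linfP => n /=; rewrite add0r. Qed.
Let addN : left_inverse linf_zero linf_opp linf_add.
Proof. by move=> a; apply: linfP => n /=; rewrite addNr. Qed.
HB.instance Definition _ := GRing.isZmodule.Build linf addA addC add0 addN.

Let scaleA k l a : linf_scale k (linf_scale l a) = linf_scale (k * l) a.
Proof. by apply: linfP => n /=; rewrite scalerA. Qed.
Let scale1 : left_id 1 linf_scale.
Proof. by move=> a; apply: linfP => n /=; rewrite scale1r. Qed.
Let scaleDr : right_distributive linf_scale +%R.
Proof. by move=> k a b; apply: linfP => n /=; rewrite scalerDr. Qed.
Let scaleDl a : {morph linf_scale^~ a : k l / k + l}.
Proof. by move=> k l; apply: linfP => n /=; rewrite scalerDl. Qed.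
HB.instance Definition _ :=
  GRing.Zmodule_isLmodule.Build R[i] linf scaleA scale1 scaleDr scaleDl.

Definition linf_rnorm a : R := sup (range (fun n => rnorm (a n))).

Let has_sup_linf a : has_sup (range (fun n => rnorm (a n))).
Proof.
split; first by exists (rnorm (a 0%N)), 0%N.
by case: (linf_bounded a) => M aM; exists M => _ [n _ <-].
Qed.

Lemma le_linf_rnorm a n : rnorm (a n) <= linf_rnorm a.
Proof. by apply: sup_upper_bound; [exact: has_sup_linf|exists n]. Qed.

Lemma linf_rnorm_le a (M : R) : (forall n, rnorm (a n) <= M) -> linf_rnorm a <= M.
Proof.
by move=> aM; apply: ge_sup; [exact: (has_sup_linf a).1|move=> _ [n _ <-]].
Qed.

Let normD a b : (linf_rnorm (a + b))%:C <= (linf_rnorm a)%:C + (linf_rnorm b)%:C.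
Proof.
rewrite -rmorphD lecR; apply: linf_rnorm_le => n /=.
by apply: le_trans (rnormD _ _) _; rewrite lerD // le_linf_rnorm.
Qed.

Let normZ (k : R[i]) a : (linf_rnorm (k *: a))%:C = `|k| * (linf_rnorm a)%:C.
Proof.
rewrite (ger0_ReE (normr_ge0 k)).
have k0 := Re_norm_ge0 k; rewrite -rmorphM; congr (_%:C).
apply/eqP; rewrite eq_le; apply/andP; split.
  by apply: linf_rnorm_le => n /=; rewrite rnormZ ler_wpM2l // le_linf_rnorm.
move: k0; rewrite [X in is_true X -> _]le_eqVlt => /predU1P[<-|k0].
  by rewrite mul0r (le_trans (rnorm_ge0 _) (le_linf_rnorm _ 0%N)).
rewrite -ler_pdivlMl //; apply: linf_rnorm_le => n.
by rewrite ler_pdivlMl // -rnormZ (le_linf_rnorm (k *: a)).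
Qed.

Let norm0_eq0 a : (linf_rnorm a)%:C = 0 -> a = 0.
Proof.
move=> [a0]; apply: linfP => n /=; apply: rnorm_eq0.
by apply/le_anti; rewrite rnorm_ge0 andbT -a0 le_linf_rnorm.
Qed.

HB.instance Definition _ :=
  @Lmodule_isNormed.Build R[i] linf (fun a => (linf_rnorm a)%:C)
    normD normZ norm0_eq0.

Lemma linf_rnormE a : rnorm a = linf_rnorm a.
Proof. by []. Qed.

Let linf_complete (F : set_system linf) : ProperFilter F -> cauchy F -> cvg F.
Proof.
apply: fast_complete_cvg => u fu.
have ex_l n : exists l : A n, forall k, rnorm (u k n - l) <= 2^-1 ^+ k *+ 2.
  apply: (@complete_fast _ (A n) (fun k => u k n)) => k.
  by apply: le_lt_trans (fu k); exact: (le_linf_rnorm (u k.+1 - u k)).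
pose l n := projT1 (cid (ex_l n)).
have lP n k : rnorm (u k n - l n) <= 2^-1 ^+ k *+ 2 by rewrite /l; case: cid.
have lM : bounded_seq l.
  exists (linf_rnorm (u 0%N) + 2) => n.
  rewrite -(subrK (u 0%N n) (l n)) addrC; apply: le_trans (rnormD _ _) _.
  by rewrite lerD ?le_linf_rnorm // rnorm_distC (lP n 0%N).
by exists (Linf lM) => k; apply: linf_rnorm_le => n /=; exact: lP.
Qed.

HB.instance Definition _ := Uniform_isComplete.Build linf linf_complete.

Let mulA : associative linf_mul.
Proof. by move=> a b c; apply: linfP => n /=; rewrite bmulA. Qed.
Let mulDl : left_distributive linf_mul +%R.
Proof. by move=> a b c; apply: linfP => n /=; rewrite bmulDl. Qed.
Let mulDr : right_distributive linf_mul +%R.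
Proof. by move=> a b c; apply: linfP => n /=; rewrite bmulDr. Qed.
Let mulZl (k : R[i]) a b : linf_mul (k *: a) b = k *: linf_mul a b.
Proof. by apply: linfP => n /=; rewrite bmulZl. Qed.
Let mulZr (k : R[i]) a b : linf_mul a (k *: b) = k *: linf_mul a b.
Proof. by apply: linfP => n /=; rewrite bmulZr. Qed.
Let mul_norm_le a b : `|linf_mul a b| <= `|a| * `|b|.
Proof.
rewrite -!rnormE -rmorphM lecR; apply: linf_rnorm_le => n /=.
by apply: le_trans (rnormM _ _) _; rewrite ler_pM ?rnorm_ge0 // le_linf_rnorm.
Qed.

HB.instance Definition _ :=
  CompleteNormedModule_isBanachAlgebra.Build R[i] linf
    mulA mulDl mulDr mulZl mulZr mul_norm_le.

End BoundedSequences.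

Section Asymptotic.
Variables (R : realType) (A : nat -> banachAlgType R[i]).
Implicit Types a b : linf A.

Definition c0 : {pred linf A} := fun a => `[< rnorm (a n) @[n --> \oo] --> (0 : R) >].

Lemma c0P a : reflect
  (forall e : R, 0 < e -> \forall n \near \oo, rnorm (a n) < e) (a \in c0).
Proof.
apply: (iffP (asboolP _)) => [/cvgrPdist_lt a0 e /a0|a0].
  by apply: filterS => n; rewrite sub0r normrN ger0_norm ?rnorm_ge0.
apply/cvgrPdist_lt => e /a0; apply: filterS => n.
by rewrite sub0r normrN ger0_norm ?rnorm_ge0.
Qed.

Let c0_zmod_closed : zmod_closed c0.
Proof.
split=> [|a b /c0P a0 /c0P b0]; apply/c0P => e e0.
  by apply: nearW => n; rewrite rnorm0.
have e2 : 0 < e / 2 by rewrite divr_gt0.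
apply: filterS2 (a0 _ e2) (b0 _ e2) => n an bn.
apply: le_lt_trans (rnormD _ _) _.
by rewrite rnormN (splitr e) ltrD.
Qed.

HB.instance Definition _ := GRing.isZmodClosed.Build (linf A) c0 c0_zmod_closed.

Lemma c0_dom a b (M : R) : (forall n, rnorm (b n) <= M * rnorm (a n)) ->
  a \in c0 -> b \in c0.
Proof.
move=> abM /c0P a0; apply/c0P => e e0.
have M0 : 0 < `|M| + 1 by rewrite ltr_wpDl.
apply: filterS (a0 (e / (`|M| + 1)) _) => [n|]; last by rewrite divr_gt0.
rewrite ltr_pdivlMr // mulrC; apply: le_lt_trans.
apply: le_trans (abM n) _; rewrite ler_wpM2r ?rnorm_ge0 //.
by rewrite (le_trans (ler_norm _)) // lerDl.
Qed.

Lemma c0Z (k : R[i]) a : a \in c0 -> k *: a \in c0.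
Proof. by apply: (@c0_dom _ _ (complex.Re `|k|)) => n; rewrite /= rnormZ. Qed.

Lemma c0Ml a b : b \in c0 -> a ** b \in c0.
Proof.
apply: (@c0_dom _ _ (rnorm a)) => n; apply: le_trans (rnormM _ _) _.
by rewrite ler_wpM2r ?rnorm_ge0 // le_linf_rnorm.
Qed.

Lemma c0Mr a b : a \in c0 -> a ** b \in c0.
Proof.
apply: (@c0_dom _ _ (rnorm b)) => n; apply: le_trans (rnormM _ _) _.
by rewrite mulrC ler_wpM2r ?rnorm_ge0 // le_linf_rnorm.
Qed.

Lemma closed_c0 : closed [set a : linf A | a \in c0].
Proof.
move=> a acl; apply/c0P => e e0.
have e2 : 0 < e / 2 by rewrite divr_gt0.
have [|b [/= /c0P/(_ _ e2) b0]] := acl (ball a (e / 2)%:C).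
  by apply: nbhsx_ballx; rewrite ltcR.
rewrite -ball_normE /= -rnormE ltcR => ab.
apply: filterS b0 => n bn; rewrite -(subrK (b n) (a n)).
apply: le_lt_trans (rnormD _ _) _; rewrite (splitr e) ltrD //.
by apply: le_lt_trans ab; exact: (le_linf_rnorm (a - b)).
Qed.

(* {ideal_quot c0} only uses that c0 is an additive subgroup; the rest of the
   structure below relies on c0Z, c0Ml, c0Mr (two-sided ideal) and gives Asy the
   product induced by linf and the quotient norm asy_rnorm. *)
Definition Asy := {ideal_quot c0}.

HB.instance Definition _ := Choice.on Asy.
HB.instance Definition _ := GRing.Zmodule.on Asy.
HB.instance Definition _ := ZmodQuotient.on Asy.

Implicit Types p q r : Asy.

Lemma eq_AsyP a b : reflect (\pi_Asy a = \pi_Asy b) (a - b \in c0).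
Proof. by rewrite Quotient.idealrBE; exact: eqP. Qed.

Definition asy_scale (k : R[i]) := lift_op1 Asy ( *:%R k).
Definition asy_mul := lift_op2 Asy (@bmul R[i] (linf A)).

Lemma pi_asyZ k a : \pi_Asy (k *: a) = asy_scale k (\pi_Asy a).
Proof.
unlock asy_scale; apply/eq_AsyP; rewrite -scalerBr c0Z //.
by apply/eq_AsyP; rewrite reprK.
Qed.

Lemma pi_asyM a b : \pi_Asy (a ** b) = asy_mul (\pi_Asy a) (\pi_Asy b).
Proof.
unlock asy_mul; set a' := repr _; set b' := repr _; apply/eq_AsyP.
have -> : a ** b - a' ** b' = (a - a') ** b + a' ** (b - b').
  by rewrite bmulBl bmulBr addrA subrK.
by apply: rpredD; [apply: c0Mr|apply: c0Ml]; apply/eq_AsyP; rewrite reprK.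
Qed.

Lemma pi_asyD a b : \pi_Asy (a + b) = \pi_Asy a + \pi_Asy b.
Proof. by rewrite !piE. Qed.

Lemma pi_asyB a b : \pi_Asy (a - b) = \pi_Asy a - \pi_Asy b.
Proof. by rewrite !piE. Qed.

Let scaleA k l q : asy_scale k (asy_scale l q) = asy_scale (k * l) q.
Proof. by rewrite -[q]reprK -!pi_asyZ scalerA. Qed.
Let scale1 : left_id 1 asy_scale.
Proof. by move=> q; rewrite -[q]reprK -pi_asyZ scale1r. Qed.
Let scaleDr : right_distributive asy_scale +%R.
Proof.
move=> k p q; rewrite -[p]reprK -[q]reprK.
by rewrite -pi_asyD -!pi_asyZ -pi_asyD scalerDr.
Qed.
Let scaleDl q : {morph asy_scale^~ q : k l / k + l}.
Proof.
by move=> k l; rewrite -[q]reprK -!pi_asyZ -pi_asyD scalerDl.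
Qed.
HB.instance Definition _ :=
  GRing.Zmodule_isLmodule.Build R[i] Asy scaleA scale1 scaleDr scaleDl.

Definition asy_rnorm q : R := inf [set rnorm a | a in [set a | \pi_Asy a = q]].

Let has_inf_asy q : has_inf [set rnorm a | a in [set a | \pi_Asy a = q]].
Proof.
split; first by exists (rnorm (repr q)), (repr q) => //=; rewrite reprK.
by exists 0 => _ [a _ <-]; exact: rnorm_ge0.
Qed.

Lemma asy_rnorm_le a : asy_rnorm (\pi_Asy a) <= rnorm a.
Proof. by apply: ge_inf; [exact: (has_inf_asy _).2|exists a]. Qed.

Lemma asy_rnorm_ge0 q : 0 <= asy_rnorm q.
Proof.
apply: lb_le_inf; first exact: (has_inf_asy q).1.
by move=> _ [a _ <-]; exact: rnorm_ge0.
Qed.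

Lemma asy_rnorm_lift q (e : R) : asy_rnorm q < e ->
  exists2 a, \pi_Asy a = q & rnorm a < e.
Proof.
move=> qe; have e0 : 0 < e - asy_rnorm q by rewrite subr_gt0.
have [_ [a aq <-]] := inf_adherent e0 (has_inf_asy q).
by rewrite -/(asy_rnorm q) addrC subrK => ae; exists a.
Qed.

Let normD p q : (asy_rnorm (p + q))%:C <= (asy_rnorm p)%:C + (asy_rnorm q)%:C.
Proof.
rewrite -rmorphD lecR; apply/ler_addgt0Pr => e e0.
have e2 : 0 < e / 2 by rewrite divr_gt0.
have [a <- ae] : exists2 a, \pi_Asy a = p & rnorm a < asy_rnorm p + e / 2.
  by apply: asy_rnorm_lift; rewrite ltrDl.
have [b <- be] : exists2 a, \pi_Asy a = q & rnorm a < asy_rnorm q + e / 2.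
  by apply: asy_rnorm_lift; rewrite ltrDl.
rewrite -pi_asyD; apply: le_trans (asy_rnorm_le _) _.
apply: le_trans (rnormD _ _) _.
move: ae be; set x := asy_rnorm _; set y := asy_rnorm _; lra.
Qed.

Let normZ_le (k : R[i]) q : asy_rnorm (k *: q) <= complex.Re `|k| * asy_rnorm q.
Proof.
apply/ler_addgt0Pr => e e0.
have k0 := Re_norm_ge0 k.
have k1 : 0 < complex.Re `|k| + 1 by rewrite ltr_wpDl.
have [a <- ae] :
    exists2 a, \pi_Asy a = q & rnorm a < asy_rnorm q + e / (complex.Re `|k| + 1).
  by apply: asy_rnorm_lift; rewrite ltrDl divr_gt0.
rewrite -[_ *: _]pi_asyZ; apply: le_trans (asy_rnorm_le _) _.
rewrite rnormZ; apply: le_trans (ler_wpM2l k0 (ltW ae)) _.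
rewrite mulrDr lerD2l mulrCA ger_pMr // ler_pdivrMr // mul1r lerDl.
by [].
Qed.

Let normZ (k : R[i]) q : (asy_rnorm (k *: q))%:C = `|k| * (asy_rnorm q)%:C.
Proof.
rewrite (ger0_ReE (normr_ge0 k)) -rmorphM; congr (_%:C).
apply/eqP; rewrite eq_le normZ_le andTb.
have [->|k0] := eqVneq k 0; first by rewrite normr0 mul0r asy_rnorm_ge0.
have nk0 : 0 < complex.Re `|k| by move: k0; rewrite -normr_gt0 ltcE => /andP[_].
rewrite -ler_pdivlMl // -[in leLHS](scalerK k0 q).
apply: le_trans (normZ_le _ _) _.
suff -> : complex.Re `|k^-1| = (complex.Re `|k|)^-1 by [].
apply: complexI; rewrite fmorphV -!ger0_ReE //; exact: normfV.
Qed.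

Let norm0_eq0 q : (asy_rnorm q)%:C = 0 -> q = 0.
Proof.
move=> [q0]; rewrite -[q]reprK; set a := repr q.
suff /eq_AsyP : a - 0 \in c0 by rewrite piE.
rewrite subr0; apply/c0P => e e0.
have e2 : 0 < e / 2 by rewrite divr_gt0.
have [b bq be] : exists2 b, \pi_Asy b = q & rnorm b < e / 2.
  by apply: asy_rnorm_lift; rewrite q0.
have /c0P/(_ _ e2) : a - b \in c0 by apply/eq_AsyP; rewrite bq reprK.
apply: filterS => n abn; rewrite -(subrK (b n) (a n)).
apply: le_lt_trans (rnormD _ _) _; rewrite (splitr e) ltrD //.
by apply: le_lt_trans be; exact: le_linf_rnorm.
Qed.

HB.instance Definition _ :=
  @Lmodule_isNormed.Build R[i] Asy (fun q => (asy_rnorm q)%:C)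
    normD normZ norm0_eq0.

Let asy_complete (F : set_system Asy) : ProperFilter F -> cauchy F -> cvg F.
Proof.
apply: fast_complete_cvg => u fu.
have /choice[d dP] k :
    exists d, \pi_Asy d = u k.+1 - u k /\ rnorm d < 2^-1 ^+ k.
  by have [d dE dk] := asy_rnorm_lift (fu k); exists d.
pose v k := repr (u 0%N) + \sum_(i < k) d i.
have vE k : \pi_Asy (v k) = u k.
  elim: k => [|k IH]; first by rewrite /v big_ord0 addr0 reprK.
  by rewrite /v big_ord_recr addrA pi_asyD IH (dP k).1 addrC subrK.
have fv : fast_cauchy v.
  move=> k; have -> : v k.+1 - v k = d k.
    by rewrite /v big_ord_recr /= addrA addrC addrK.
  exact: (dP k).2.
have [l lP] := @complete_fast _ (linf A) v fv.
exists (\pi_Asy l) => k; rewrite -vE -pi_asyB.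
exact: le_trans (asy_rnorm_le _) (lP k).
Qed.

HB.instance Definition _ := Uniform_isComplete.Build Asy asy_complete.

Let mulA : associative asy_mul.
Proof.
by move=> p q r; rewrite -[p]reprK -[q]reprK -[r]reprK -!pi_asyM bmulA.
Qed.
Let mulDl : left_distributive asy_mul +%R.
Proof.
move=> p q r; rewrite -[p]reprK -[q]reprK -[r]reprK.
by rewrite -pi_asyD -!pi_asyM -pi_asyD bmulDl.
Qed.
Let mulDr : right_distributive asy_mul +%R.
Proof.
move=> p q r; rewrite -[p]reprK -[q]reprK -[r]reprK.
by rewrite -pi_asyD -!pi_asyM -pi_asyD bmulDr.
Qed.
Let mulZl (k : R[i]) p q : asy_mul (k *: p) q = k *: asy_mul p q.
Proof.
rewrite -[p]reprK -[q]reprK.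
by rewrite -[k *: _]pi_asyZ -!pi_asyM -[RHS]pi_asyZ bmulZl.
Qed.
Let mulZr (k : R[i]) p q : asy_mul p (k *: q) = k *: asy_mul p q.
Proof.
rewrite -[p]reprK -[q]reprK.
by rewrite -[k *: _]pi_asyZ -!pi_asyM -[RHS]pi_asyZ bmulZr.
Qed.
Let mul_norm_le p q : `|asy_mul p q| <= `|p| * `|q|.
Proof.
rewrite -!rnormE -rmorphM lecR; apply/ler_addgt0Pr => e e0.
change (asy_rnorm (asy_mul p q) <= asy_rnorm p * asy_rnorm q + e).
have := asy_rnorm_ge0 p; have := asy_rnorm_ge0 q.
set s := asy_rnorm p; set t := asy_rnorm q => t0 s0.
have m0 : 0 < s + t + 1 by lra.
pose f := Num.min 1 (e / (s + t + 1)).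
have f0 : 0 < f by rewrite lt_min ltr01 divr_gt0.
have [a aE af] : exists2 a, \pi_Asy a = p & rnorm a < s + f.
  by apply: asy_rnorm_lift; rewrite ltrDl.
have [b bE bf] : exists2 b, \pi_Asy b = q & rnorm b < t + f.
  by apply: asy_rnorm_lift; rewrite ltrDl.
rewrite -aE -bE -pi_asyM; apply: le_trans (asy_rnorm_le _) _.
apply: le_trans (rnormM _ _) _.
apply: le_trans (ler_pM (rnorm_ge0 _) (rnorm_ge0 _) (ltW af) (ltW bf)) _.
have f1 : f <= 1 by rewrite ge_min lexx.
have fe : f * (s + t + 1) <= e by rewrite -ler_pdivlMr // ge_min lexx orbT.
have ff : f * f <= f by rewrite ger_pMr.
have -> : (s + f) * (t + f) = s * t + f * (s + t) + f * f.
  by rewrite mulrDl !mulrDr (mulrC s f) !addrA.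
by move: fe; rewrite mulrDr mulr1; lra.
Qed.

HB.instance Definition _ :=
  CompleteNormedModule_isBanachAlgebra.Build R[i] Asy
    mulA mulDl mulDr mulZl mulZr mul_norm_le.

End Asymptotic.

(* Main.v *)
Require Import Defs.
From HB Require Import structures.
From mathcomp Require Import all_boot all_order all_algebra.
From mathcomp Require Import complex.
From mathcomp Require Import all_classical all_reals all_analysis.
From mathcomp Require Import ring.

(** Let [A n] be the complex field with its usual norm and the rescaled product
    [x * y / (n + 1)]; its identity is [n + 1].  A product of two bounded
    sequences tends to [0], so the product of [Asy A] vanishes identically,
    while the constant sequence [1] represents a nonzero element of [Asy A]. *)

Import Order.TTheory GRing.Theory Num.Theory.
Import numFieldNormedType.Exports.

Local Open Scope classical_set_scope.
Local Open Scope complex_scope.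
Local Open Scope ring_scope.
Local Open Scope quotient_scope.

Section ComplexComplete.
Context {R : realType}.
Implicit Types z : R[i].

Lemma norm_Re_le z : `|complex.Re z| <= complex.Re `|z|.
Proof. by have := normc_ge_Re z; rewrite lecE => /andP[]. Qed.

(** Multiplication by ['i] preserves the norm and turns the imaginary part, up to sign, into a real
    part. *)
Lemma norm_Im_le z : `|complex.Im z| <= complex.Re `|z|.
Proof.
have i1 : `|'i| = 1 :> R[i] by rewrite normc_def /= expr0n expr1n add0r sqrtr1.
by rewrite -normrN -ReiNIm (le_trans (norm_Re_le _)) // normrM i1 mulr1.
Qed.

Lemma norm_le_ReIm z : `|z| <= (`|complex.Re z| + `|complex.Im z|)%:C.
Proof.
rewrite {1}[z]complexE (le_trans (ler_normD _ _)) // normrM !normc_def /=.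
by rewrite !(expr0n, expr1n) !(add0r, addr0) sqrtr1 mul1r !sqrtr_sqr rmorphD.
Qed.

(** A 1-Lipschitz map carries a Cauchy filter to a Cauchy filter on the complete space [R]; it is
    applied to the real and imaginary parts. *)
Lemma cauchy_cvg_proj (f : R[i]^o -> R) (F : set_system R[i]^o) :
  (forall x y, `|f x - f y| <= complex.Re `|x - y|) ->
  ProperFilter F -> cauchy F -> cvg (f @ F).
Proof.
move=> fle FF /cauchy_ballP Fc; apply: cauchy_cvg; apply/cauchy_ballP => e e0.
have eC : 0 < e%:C by rewrite ltcR.
have [[P Q] /= [FP FQ] PQ] := Fc _ eC.
exists (f @` P, f @` Q) => /=.
  by split; [apply: filterS FP|apply: filterS FQ] => x ?; exists x.
move=> [_ _] /= [[x Px <-] [y Qy <-]].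
have := PQ (x, y) (conj Px Qy); rewrite -!ball_normE /=.
by rewrite ltcE => /andP[_] /=; apply: le_lt_trans.
Qed.

Lemma complex_cauchy_cvg (F : set_system R[i]^o) :
  ProperFilter F -> cauchy F -> cvg F.
Proof.
move=> FF Fc.
have /cvg_ex[a /cvgrPdist_lt Fa] : cvg (@complex.Re R @ F).
  (* Once [x] and [y] are destructed, the real part of [x - y] computes to the difference of real
     parts. *)
  by apply: cauchy_cvg_proj => // x y; have := norm_Re_le (x - y); case: x y => ? ? [].
have /cvg_ex[b /cvgrPdist_lt Fb] : cvg (@complex.Im R @ F).
  by apply: cauchy_cvg_proj => // x y; have := norm_Im_le (x - y); case: x y => ? ? [].
apply/cvg_ex; exists (a +i* b); apply/cvgrPdist_lt => e e0.
(* A positive [e] in [R[i]] is real; half of it is allotted to each coordinate. *)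
have Re0 : 0 < complex.Re e / 2.
  by rewrite divr_gt0 //; move: e0; rewrite ltcE => /andP[].
apply: filterS2 (Fa _ Re0) (Fb _ Re0) => -[x y] /= ax bY.
rewrite (ger0_ReE (ltW e0)) (le_lt_trans (norm_le_ReIm _)) // ltcR.
by rewrite (splitr (complex.Re e)) ltrD.
Qed.

End ComplexComplete.

(** A separate alias for each [n] lets the instances carry a product that depends on [n]. *)
Definition scaled_complex (R : realType) (n : nat) : Type := R[i]^o.

Section ScaledComplex.
Variables (R : realType) (n : nat).
Local Notation A := (scaled_complex R n).
Implicit Types x y z : A.

HB.instance Definition _ := NormedModule.on A.

HB.instance Definition _ :=
  Uniform_isComplete.Build A (@complex_cauchy_cvg R).

Let mul x y : A := (n.+1%:R^-1 : R[i]) * ((x : R[i]) * (y : R[i])).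

Let mulA : associative mul.
Proof. by move=> x y z; rewrite /mul; ring. Qed.
Let mulDl : left_distributive mul +%R.
Proof. by move=> x y z; rewrite /mul -mulrDr -mulrDl. Qed.
Let mulDr : right_distributive mul +%R.
Proof. by move=> x y z; rewrite /mul -!mulrDr. Qed.
Let mulZl (k : R[i]) x y : mul (k *: x) y = k *: mul x y.
Proof. by rewrite /mul -[k *: x]/(k * (x : R[i])) -mulrA mulrCA. Qed.
Let mulZr (k : R[i]) x y : mul x (k *: y) = k *: mul x y.
Proof.
by rewrite /mul -[k *: y]/(k * (y : R[i])) (mulrCA (x : R[i])) (mulrCA _ k).
Qed.

Let norm_mul x y : `|mul x y| = (n.+1%:R)^-1 * (`|x| * `|y|).
Proof. by rewrite /mul !normrM ger0_norm. Qed.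

Let mul_norm_le x y : `|mul x y| <= `|x| * `|y|.
Proof. by rewrite norm_mul ler_piMl ?mulr_ge0 // invf_le1 // ler1n. Qed.

HB.instance Definition _ :=
  CompleteNormedModule_isBanachAlgebra.Build R[i] A
    mulA mulDl mulDr mulZl mulZr mul_norm_le.

Lemma rnorm_scaled_mul x y :
  rnorm (x ** y) = n.+1%:R^-1 * (rnorm x * rnorm y).
Proof.
apply: complexI; rewrite rnormE norm_mul !rmorphM /= !rnormE fmorphV.
by rewrite rmorph_nat.
Qed.

(** The identity [n.+1] has norm [n.+1], so the identities form an unbounded sequence and do not
    define an element of [linf]. *)
Lemma scaled_complex_identity : has_identity A.
Proof.
have n0 : n.+1%:R != 0 :> R[i] by rewrite pnatr_eq0.
exists (n.+1%:R : R[i]) => x.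
by split; [exact: mulKf|rewrite [LHS]mulrC; exact: mulfK].
Qed.

End ScaledComplex.

Section AsyScaledComplex.
Variable R : realType.
Local Notation A := (scaled_complex R).

Lemma scaled_mul_c0 (a b : linf A) : a ** b \in @c0 R A.
Proof.
apply/c0P => e e0.
(* Adding 1 makes the bound positive even when [a] or [b] is zero, so that [e] can be divided by
   it. *)
have M0 : 0 < rnorm a * rnorm b + 1 by rewrite ltr_wpDl // mulr_ge0 ?rnorm_ge0.
near=> n.
rewrite [X in X < _]rnorm_scaled_mul.
have /le_lt_trans -> // :
    n.+1%:R^-1 * (rnorm (a n) * rnorm (b n)) <= n.+1%:R^-1 * (rnorm a * rnorm b + 1).
  rewrite ler_wpM2l // (@le_trans _ _ (rnorm a * rnorm b)) ?lerDl //.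
  by rewrite ler_pM ?rnorm_ge0 ?le_linf_rnorm.
rewrite -ltr_pdivlMr //; near: n.
by apply: near_infty_natSinv_lt (PosNum (divr_gt0 e0 M0)).
Unshelve. all: by end_near.
Qed.

Lemma bounded_one : bounded_seq (fun n => (1 : R[i]) : A n).
Proof. by exists 1 => n; rewrite /rnorm normr1. Qed.

Lemma one_notin_c0 : Linf bounded_one \notin @c0 R A.
Proof.
apply/negP => /c0P/(_ 1 ltr01)[N _ /(_ N)] /=.
by rewrite leqnn /rnorm normr1 ltxx => /(_ isT).
Qed.

Lemma Asy_scaled_no_identity : ~ has_identity (Asy A).
Proof.
move=> [e /(_ (\pi_(Asy A) (Linf bounded_one)))[+ _]].
(* With [u] the constant sequence 1, the identity law puts [u - repr e ** u] in [c0]; since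
   [repr e ** u] is also in [c0], so is [u]. *)
rewrite -[e]reprK -[_ ** _]pi_asyM => /esym/eq_AsyP c.
have /negP[] := one_notin_c0.
by rewrite -(subrK (repr e ** Linf bounded_one) (Linf _)) rpredD ?scaled_mul_c0.
Qed.

End AsyScaledComplex.

Theorem proposition3p15 (R : realType) :
  exists A : nat -> banachAlgType R[i],
    (forall n : nat, has_identity (A n)) /\ ~ has_identity (Asy A).
Proof.
exists (fun n => scaled_complex R n : banachAlgType R[i]); split.
  exact: scaled_complex_identity.
exact: Asy_scaled_no_identity.
Qed.
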